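(* For all positive integers $n$ and non-negative integers $k$, we have $$\det_{0\le i,j\le n-1}\left(\mathcal P_{j+1}(i,k)-t(xy)^{i+1}\mathcal P_{j+1}(-i-2,k)\right)$$ $$=\begin{cases} (-1)^{n_1\binom{k+1}2}\,t^{k\lfloor n_1/2\rfloor}(xy)^{(k+1)^2\binom{n_1}2}\displaystyle\sum_{s=0}^{n_1}t^{\min\{s,n_1-s\}}x^{s(k+1)}y^{(n_1-s)(k+1)} & \text{if } n=n_1(k+1),\\[3mm] (-1)^{n_1\binom{k+1}2+\binom k2}\,t^{k\lceil n_1/2\rceil}(xy)^{(k+1)^2\binom{n_1}2+n_1k(k+1)}\displaystyle\sum_{s=0}^{n_1}t^{\min\{s,n_1-s\}}x^{s(k+1)}y^{(n_1-s)(k+1)} & \text{if } n=n_1(k+1)+k,\\[3mm] 0 & \text{if } n\not\equiv 0,k\pmod{k+1},\end{cases}$$ where $n_1$ denotes a non-negative integer, while for $k=-1$ we have $$\det_{0\le i,j\le n-1}\left(\mathcal P_{j+1}(i,-1)-t(xy)^{i+1}\mathcal P_{j+1}(-i-2,-1)\right)=(1-t)^n(xy)^{\binom{n+1}2}.$$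
   Context: $x,y,t$ are indeterminates. A three-step path is a lattice path in $\mathbb Z^2$ consisting of steps from $\{(1,0),(1,1),(1,-1)\}$. The steps have weights $w((1,0))=x+y$, $w((1,1))=1$, $w((1,-1))=xy$, and the weight $w(P)$ of a path $P$ is the product of the weights of its steps (the empty path has weight $1$). For integers $n\ge 0$ and $l,k$ (possibly negative), $\mathcal P_n(l,k)=\sum_P w(P)$, where the sum is over all three-step paths $P$ from $(0,l)$ to $(n,k)$ (with no restriction about the $x$-axis). For $k=0$ the first two cases coincide and give the same value, and only they apply. In the matrices, $i$ is the row index and $j$ the column index. *)

(* Defs.v *)
From HB Require Import structures.
From mathcomp Require Import all_boot all_order all_algebra.
From mathcomp Require Import mpoly.

Set Implicit Arguments.
Unset Strict Implicit.
Unset Printing Implicit Defensive.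

Import GRing.Theory.
Local Open Scope ring_scope.

Inductive step : predArgType := Level | Up | Down.

Definition step_vec (s : step) : int * int :=
  match s with
  | Level => (1, 0)
  | Up => (1, 1)
  | Down => (1, -1)
  end.

Definition ord_of_step (s : step) : 'I_3 :=
  match s with
  | Level => @Ordinal 3 0 isT
  | Up => @Ordinal 3 1 isT
  | Down => @Ordinal 3 2 isT
  end.

Definition step_of_ord (i : 'I_3) : step :=
  match val i with
  | 0%N => Level
  | 1%N => Up
  | _ => Down
  end.

Lemma ord_of_stepK : cancel ord_of_step step_of_ord.
Proof. by case. Qed.

HB.instance Definition _ := Countable.copy step (can_type ord_of_stepK).
HB.instance Definition _ : isFinite step := CanIsFinite ord_of_stepK.

Definition is_path (A B : int * int) (p : seq step) : bool :=
  A + \sum_(s <- p) step_vec s == B.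

(* Every step raises the abscissa by 1, so restricting to sequences of
   exactly n steps in [path_sum] below loses no path. *)
Lemma is_path_size (n : nat) (l k : int) (p : seq step) :
  is_path (0, l) (n%:Z, k) p -> size p = n.
Proof.
have sum1 q : (\sum_(s <- q) step_vec s).1 = (size q)%:Z.
  elim: q => [|s q IHq]; first by rewrite big_nil.
  by rewrite big_cons /= IHq intS; case: s.
by move/eqP/(congr1 fst); rewrite /= add0r sum1 => -[].
Qed.

Section Weights.
Variables (R : comNzRingType) (x y : R).

Definition step_weight (s : step) : R :=
  match s with
  | Level => x + y
  | Up => 1
  | Down => x * y
  end.

Definition path_weight (p : seq step) : R := \prod_(s <- p) step_weight s.

Definition path_sum (n : nat) (l k : int) : R :=
  \sum_(p : n.-tuple step | is_path (0, l) (n%:Z, k) p) path_weight p.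

Definition path_mx (t : R) (n : nat) (k : int) : 'M[R]_n :=
  \matrix_(i < n, j < n)
    (path_sum j.+1 i%:Z k
     - t * (x * y) ^+ i.+1 * path_sum j.+1 (- i%:Z - 2) k).

End Weights.

(* Main.v *)
(* Put q = x y, p = k + 1, u = t q^p, and let c_j(m) be the coefficient of w^m
   in (w + x + y + q/w)^j, so that P_j(l, k) = c_j(k - l) and
   c_j(-m) = q^m c_j(m).  The factor j + 1 >= 1 in the columns means that the
   Laurent polynomials involved vanish at w = -x, i.e.
   sum_(m >= 0) e_m c_(j+1)(m) = 0 with e_0 = 1, e_m = (-x)^m + (-y)^m.
   Bordering the matrix M by this linear form yields
     [1 0; * M] = K B,   B(m, j) = c_j(m) - u c_j(m + 2p),
   where B is unitriangular.  The rows of K are the form e, then k rows, one for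
   each i < k, supported on the residues +-(k - i) modulo 2p, and finally the
   rows q^r delta_r; the first k + 1 rows are obtained by solving
   K(m) - u K(m - 2p) = h(m).  Expanding det K along the rows q^r delta_r leaves
   a (k+1) x (k+1) matrix, on k + 1 consecutive columns, which is monomial up to
   its first row or has a zero row, according to n modulo p. *)
Require Import Defs.
From mathcomp Require Import all_boot all_order all_algebra.
From mathcomp Require Import mpoly.
From mathcomp Require Import ring zify.

Set Implicit Arguments.
Unset Strict Implicit.
Unset Printing Implicit Defensive.

Import GRing.Theory.
Local Open Scope ring_scope.

(** * Path sums as coefficients: translation, reflection, vanishing *)

Section PathSum.
Variables (R : comNzRingType) (x y : R).

Lemma big_step (F : step -> R) : \sum_s F s = F Level + F Up + F Down.
Proof.
have bij : bijective step_of_ord.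
  exists ord_of_step; last exact: ord_of_stepK.
  by case=> [[|[|[|?]]] ?] //; apply: val_inj.
rewrite (reindex _ (onW_bij _ bij)) !big_ord_recl big_ord0 /=.
by rewrite addr0 addrA.
Qed.

Lemma path_sum0 l k : path_sum x y 0 l k = (l == k)%:R.
Proof.
rewrite /path_sum big_mkcond (big_pred1 [tuple]) => [|p]; last first.
  by rewrite [p]tuple0; apply/esym/eqP.
rewrite /is_path big_nil addr0 /path_weight big_nil xpair_eqE eqxx /=.
by case: eqP.
Qed.

Lemma path_sumS n l k :
  path_sum x y n.+1 l k =
    (x + y) * path_sum x y n l k + path_sum x y n (l + 1) k
    + x * y * path_sum x y n (l - 1) k.
Proof.
rewrite /path_sum big_mkcond.
pose f (sp : step * n.-tuple step) : n.+1.-tuple step := [tuple of sp.1 :: sp.2].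
have bij : bijective f.
  exists (fun p => (thead p, [tuple of behead p])) => [[s p]|p].
    by congr pair; apply: val_inj.
  by rewrite /f /= -tuple_eta.
rewrite (reindex f (onW_bij _ bij)) /=.
rewrite -(pair_big xpredT xpredT (fun (s : step) (p : n.-tuple step) =>
  if is_path (0, l) (n.+1%:Z, k) (s :: p) then path_weight x y (s :: p) else 0)).
have shift s : \sum_(p : n.-tuple step)
    (if is_path (0, l) (n.+1%:Z, k) (s :: p) then path_weight x y (s :: p) else 0)
    = step_weight x y s * path_sum x y n (l + (step_vec s).2) k.
  rewrite /path_sum mulr_sumr [RHS]big_mkcond; apply: eq_bigr => p _ /=.
  rewrite /path_weight big_cons /is_path big_cons.
  congr (if _ then _ else _).
  case: (\sum_(s <- p) _) => a b; rewrite !xpair_eqE /=.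
  by case: s => /=; congr andb; lia.
by rewrite big_step !shift /= mul1r addr0.
Qed.

Lemma path_sum_shift n l k : path_sum x y n l k = path_sum x y n 0 (k - l).
Proof.
elim: n l k => [|n IH] l k; first by rewrite !path_sum0; congr (_%:R); lia.
rewrite !path_sumS (IH l) (IH (l + 1)) (IH (l - 1)) (IH (0 + 1)) (IH (0 - 1)).
by congr (_ * path_sum _ _ _ _ _ + path_sum _ _ _ _ _ + _ * path_sum _ _ _ _ _);
  lia.
Qed.

Lemma path_sum0S n k :
  path_sum x y n.+1 0 k =
    (x + y) * path_sum x y n 0 k + path_sum x y n 0 (k - 1)
    + x * y * path_sum x y n 0 (k + 1).
Proof.
rewrite path_sumS (path_sum_shift _ (0 + 1)) (path_sum_shift _ (0 - 1)).
by rewrite add0r sub0r opprK.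
Qed.

(** Reflection in the axis exchanges up and down steps; a path ending at height m has m more up
    steps than down steps, which accounts for the power of xy. *)
Lemma path_sumN n (m : nat) :
  path_sum x y n 0 (- m%:Z) = (x * y) ^+ m * path_sum x y n 0 m%:Z.
Proof.
elim: n m => [|n IH] [|m]; rewrite ?expr0 ?mul1r ?oppr0 //.
  by rewrite !path_sum0 (_ : (0 == - m.+1%:Z) = false) ?mulr0 //; lia.
rewrite !path_sum0S.
have -> : - m.+1%:Z - 1 = - m.+2%:Z by lia.
have -> : - m.+1%:Z + 1 = - m%:Z by lia.
have -> : m.+1%:Z - 1 = m by lia.
have -> : m.+1%:Z + 1 = m.+2 by lia.
rewrite !IH !exprS; ring.
Qed.

Lemma path_sum_high n m : (n < m)%N -> path_sum x y n 0 m%:Z = 0.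
Proof.
elim: n m => [|n IH] [|m] // ltnm; first by rewrite path_sum0.
rewrite path_sum0S; have -> : m.+1%:Z - 1 = m by lia.
have -> : m.+1%:Z + 1 = m.+2 by lia.
by rewrite !IH ?mulr0 ?addr0 //; lia.
Qed.

Lemma path_sum_diag n : path_sum x y n 0 n%:Z = 1.
Proof.
elim: n => [|n IH]; first by rewrite path_sum0.
rewrite path_sum0S; have -> : n.+1%:Z - 1 = n by lia.
have -> : n.+1%:Z + 1 = n.+2 by lia.
by rewrite IH !path_sum_high ?mulr0 ?addr0 ?add0r //; lia.
Qed.

(** Evaluation at w = -x, folded onto m >= 0: by reflection the term at -m contributes (-y)^m times
    the coefficient at m. The term m = 0 is its own mirror image, hence 1 and not 2. *)
Definition npow (m : nat) : R :=
  if m is 0 then 1 else (- x) ^+ m + (- y) ^+ m.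

(** The sum telescopes, since power sums of -x and -y satisfy e_(m+2) + (x+y) e_(m+1) + xy e_m = 0
    for m >= 1. As e_0 is 1 instead of 2, the closed form starts at N = 1 only. *)
Lemma sum_npow_path_sum n N : (0 < N)%N ->
  \sum_(m < N.+1) npow m * path_sum x y n.+1 0 m%:Z =
    x * y * npow N * path_sum x y n 0 N.+1%:Z
    - npow N.+1 * path_sum x y n 0 N%:Z.
Proof.
case: N => // N _; elim: N => [|N IH].
  rewrite !big_ord_recr big_ord0 /= !path_sum0S.
  rewrite (_ : 0%:Z - 1 = - 1%:Z) // (_ : 1%:Z - 1 = 0) // path_sumN.
  rewrite (_ : 0%:Z + 1 = 1) // (_ : 1%:Z + 1 = 2) //.
  ring.
rewrite big_ord_recr /= IH path_sum0S.
have -> : N.+2%:Z - 1 = N.+1 by lia.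
have -> : N.+2%:Z + 1 = N.+3 by lia.
rewrite /npow !exprS; ring.
Qed.

Lemma sum_npow_path_sum_eq0 n N : (n < N)%N ->
  \sum_(m < N.+1) npow m * path_sum x y n.+1 0 m%:Z = 0.
Proof.
move=> ltnN; rewrite sum_npow_path_sum ?(leq_trans _ ltnN) //.
by rewrite !path_sum_high ?mulr0 ?subr0 //; lia.
Qed.

End PathSum.

(** * Solving K(m) - u K(m - b) = h(m) *)

Section Lift.
Variables (R : comNzRingType) (u : R) (b : nat).

Definition lift_seq (h : nat -> R) (m : nat) : R :=
  \sum_(i < (m %/ b).+1) u ^+ i * h (m - i * b)%N.

Lemma lift_seq_small h m : (m < b)%N -> lift_seq h m = h m.
Proof.
by move=> ltmb; rewrite /lift_seq divn_small // big_ord1 mul1r subn0.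
Qed.

Lemma lift_seqD h m : (0 < b)%N ->
  lift_seq h (m + b) = h (m + b)%N + u * lift_seq h m.
Proof.
move=> b_gt0; rewrite /lift_seq divnDr // divnn b_gt0 addn1 big_ord_recl.
rewrite mul1r subn0 mulr_sumr; congr (_ + _); apply: eq_bigr => i _.
by rewrite lift0 exprS mulrA mulSn subnDA addnK.
Qed.

Lemma lift_seq_finite h m i : (0 < b)%N -> (forall j, (b <= j)%N -> h j = 0) ->
  (m < b)%N -> lift_seq h (i * b + m) = u ^+ i * h m.
Proof.
move=> b_gt0 h0 ltmb; elim: i => [|i IH]; first by rewrite mul1r lift_seq_small.
rewrite mulSn -addnA addnC lift_seqD // h0; last by rewrite leq_addl.
by rewrite IH add0r exprS mulrA.
Qed.

(** Summation by parts: the operator acting on [f] is moved onto [lift_seq h], where it gives back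
    [h]. The vanishing of [f] from [N] on removes the boundary terms. *)
Lemma sum_lift_seq h (f : nat -> R) N : (0 < b)%N ->
    (forall m, (N <= m)%N -> f m = 0) ->
  \sum_(m < N) lift_seq h m * (f m - u * f (m + b)%N) = \sum_(m < N) h m * f m.
Proof.
move=> b_gt0 f0.
have -> : \sum_(m < N) h m * f m = \sum_(m < N + b) h m * f m.
  rewrite big_split_ord /= [X in _ + X]big1 ?addr0 // => i _.
  by rewrite f0 ?mulr0 // leq_addr.
under eq_bigr => m _ do rewrite mulrBr; rewrite sumrB.
have -> : \sum_(m < N) lift_seq h m * f m = \sum_(m < N + b) lift_seq h m * f m.
  rewrite big_split_ord /= [X in _ + X]big1 ?addr0 // => i _.
  by rewrite f0 ?mulr0 // leq_addr.
rewrite (addnC N b).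
rewrite !big_split_ord /= -addrA -sumrB; congr (_ + _).
  by apply: eq_bigr => i _; rewrite lift_seq_small.
apply: eq_bigr => i _; rewrite addnC lift_seqD //; ring.
Qed.

End Lift.

(** * Determinants of arrays indexed by natural numbers *)

Section NatMatrix.
Variable R : comNzRingType.
Implicit Types F : nat -> nat -> R.

(** Entries indexed by [nat] make minors mere reindexings by [bump], with no casts between ordinal
    types. *)
Definition ndet n F : R := \det (\matrix_(i < n, j < n) F i j).

Lemma eq_ndet n F G :
  (forall i j, (i < n)%N -> (j < n)%N -> F i j = G i j) -> ndet n F = ndet n G.
Proof. by move=> FG; congr (\det _); apply/matrixP => i j; rewrite !mxE FG. Qed.

Lemma ndet_tr n F : ndet n F = ndet n (fun i j => F j i).
Proof. by rewrite /ndet -det_tr; congr (\det _); apply/matrixP => i j; rewrite !mxE. Qed.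

Lemma ndet_row n F r c : (r <= n)%N -> (c <= n)%N ->
    (forall j, (j <= n)%N -> j != c -> F r j = 0) ->
  ndet n.+1 F =
    (-1) ^+ (r + c) * F r c * ndet n (fun i j => F (bump r i) (bump c j)).
Proof.
move=> lern lecn F0; rewrite /ndet (expand_det_row _ (Ordinal (lern : r < n.+1)%N)).
rewrite (bigD1 (Ordinal (lecn : c < n.+1)%N)) //= big1 ?addr0 => [|j neqjc].
  rewrite mxE /cofactor /= mulrCA mulrA; congr (_ * \det _).
  by apply/matrixP => i j; rewrite !mxE.
by rewrite mxE /= F0 ?mul0r // -ltnS.
Qed.

Lemma ndet_diag n F :
    (forall i j, (i < n)%N -> (j < n)%N -> i != j -> F i j = 0) ->
  ndet n F = \prod_(i < n) F i i.
Proof.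
move=> F0; rewrite /ndet det_trig; first by apply: eq_bigr => i _; rewrite mxE.
by apply/is_trig_mxP => i j ltij; rewrite mxE F0 //; lia.
Qed.

Lemma ndet_antidiag n F :
    (forall i j, (i < n)%N -> (j < n)%N -> (i + j).+1 != n -> F i j = 0) ->
  ndet n F = (-1) ^+ 'C(n, 2) * \prod_(i < n) F i (n - i.+1)%N.
Proof.
elim: n F => [|n IH] F F0; first by rewrite /ndet det_mx00 big_ord0 mulr1.
rewrite (@ndet_row _ _ n 0) // => [|j lejn neqj]; last by apply: F0; lia.
rewrite IH => [|i j ltin ltjn neqij]; last by apply: F0; rewrite /bump; lia.
rewrite big_ord_recr /= subnn binS bin1 addn0 exprD.
rewrite (eq_bigr (fun i : 'I_n => F i (n.+1 - i.+1)%N)) => [|i _]; first ring.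
by congr F; rewrite /bump; have := ltn_ord i; lia.
Qed.

(** The last row is peeled off at its only nonzero column d times; the sign is that of moving d rows
    past p rows. *)
Lemma ndet_antiblock p d F (a : nat -> R) :
    (forall r j, (r < d)%N -> (j < p + d)%N -> F (p + r)%N j = a r * (j == r)%:R) ->
  ndet (p + d) F =
    (-1) ^+ (p * d) * (\prod_(r < d) a r) * ndet p (fun i j => F i (d + j)%N).
Proof.
elim: d F => [|d IH] F Fa.
  by rewrite muln0 addn0 big_ord0 !mul1r.
rewrite addnS (@ndet_row _ _ (p + d) d) ?leq_addl // => [|j lej neqj]; last first.
  by rewrite Fa ?(negPf neqj) ?mulr0 //; lia.
rewrite IH => [|r j ltr ltj]; last first.
  have -> : bump (p + d) (p + r) = (p + r)%N by rewrite /bump; lia.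
  rewrite Fa; [| lia | rewrite /bump; lia].
  by congr (_ * _%:R); rewrite /bump; lia.
rewrite Fa ?eqxx ?mulr1; [|lia..].
rewrite big_ord_recr /= mulnS (exprD _ p (p * d)).
rewrite (_ : (-1) ^+ (p + d + d) = (-1) ^+ p); last first.
  by rewrite -signr_odd -addnA addnn oddD odd_double addbF signr_odd.
have -> : ndet p (fun i j => F (bump (p + d) i) (bump d (d + j))) =
          ndet p (fun i j => F i (d.+1 + j)%N).
  by apply: eq_ndet => i j lti ltj; congr F; rewrite /bump; lia.
ring.
Qed.

Lemma ndet_row_eq0 n F r : (r < n)%N ->
  (forall j, (j < n)%N -> F r j = 0) -> ndet n F = 0.
Proof.
case: n => // n ltrn F0.
rewrite (@ndet_row _ _ r 0) // => [|j lejn _]; last exact: F0.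
by rewrite F0 // mulr0 mul0r.
Qed.

Lemma ndet_col n F r c : (r <= n)%N -> (c <= n)%N ->
    (forall i, (i <= n)%N -> i != r -> F i c = 0) ->
  ndet n.+1 F =
    (-1) ^+ (r + c) * F r c * ndet n (fun i j => F (bump r i) (bump c j)).
Proof.
by move=> lern lecn F0; rewrite ndet_tr (ndet_row lecn lern F0) addnC -ndet_tr.
Qed.

Lemma ndet_mul n F G :
  ndet n F * ndet n G = ndet n (fun i j => \sum_(m < n) F i m * G m j).
Proof.
rewrite /ndet -det_mulmx; congr (\det _); apply/matrixP => i j; rewrite !mxE.
by apply: eq_bigr => m _; rewrite !mxE.
Qed.

Lemma ndet_trig n F : (forall i j, (j < i)%N -> F i j = 0) ->
  ndet n F = \prod_(i < n) F i i.
Proof.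
move=> F0; rewrite ndet_tr /ndet det_trig.
  by apply: eq_bigr => i _; rewrite mxE.
by apply/is_trig_mxP => i j ltij; rewrite mxE F0.
Qed.

End NatMatrix.

Lemma signr_eq_odd (R : comNzRingType) a b :
  odd a = odd b -> (-1) ^+ a = (-1) ^+ b :> R.
Proof. by move=> ab; rewrite -signr_odd ab signr_odd. Qed.

Lemma bin2_double n : ('C(n, 2) * 2 + n = n * n)%N.
Proof. by elim: n => // n IH; rewrite binS bin1; lia. Qed.

Lemma prod_expr_ord (R : comNzRingType) (q : R) n :
  \prod_(i < n) q ^+ i = q ^+ 'C(n, 2).
Proof.
elim: n => [|n IH]; first by rewrite big_ord0.
by rewrite big_ord_recr /= IH binS bin1 -exprD.
Qed.

Lemma sum_delta (R : comNzRingType) (f : nat -> R) N a :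
  (forall m, (N <= m)%N -> f m = 0) -> \sum_(m < N) (m == a :> nat)%:R * f m = f a.
Proof.
move=> f0; have [ltaN|leNa] := ltnP a N; last first.
  rewrite f0 // big1 // => m _.
  by rewrite (_ : (m == a :> nat) = false) ?mul0r //; have := ltn_ord m; lia.
rewrite (bigD1 (Ordinal ltaN)) //= eqxx mul1r big1 ?addr0 // => m neqma.
by rewrite -val_eqE /= in neqma; rewrite (negPf neqma) mul0r.
Qed.

(** * The case k = -1, and the bordered factorization for k >= 0 *)

Section PathDet.
Variables (R : comNzRingType) (x y t : R).
Local Notation q := (x * y).
Local Notation c := (fun j (m : nat) => path_sum x y j 0 m%:Z).

(** For k = -1 the heights -1 - i and i + 1 are opposite, so reflection merges the two terms of each
    entry and the matrix becomes triangular. *)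
Lemma det_path_mx_neg1 n :
  \det (path_mx x y t n (-1)) = (1 - t) ^+ n * q ^+ 'C(n.+1, 2).
Proof.
have -> : \det (path_mx x y t n (-1)) =
    ndet n (fun i j => (1 - t) * q ^+ i.+1 * c j.+1 i.+1).
  congr (\det _); apply/matrixP => i j; rewrite !mxE path_sum_shift.
  rewrite (_ : -1 - i%:Z = - i.+1%:Z); last lia.
  rewrite (path_sum_shift _ _ _ (- _ - _)) (_ : -1 - (- i%:Z - 2) = i.+1%:Z); last lia.
  by rewrite path_sumN; ring.
rewrite ndet_trig => [|i j ltji]; last by rewrite path_sum_high ?mulr0.
under eq_bigr => i _ do rewrite path_sum_diag mulr1.
rewrite big_split /= prodr_const card_ord; congr (_ * _).
by rewrite -prod_expr_ord big_ord_recl mul1r.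
Qed.

Variable k : nat.
Local Notation p := k.+1.
Local Notation u := (t * q ^+ p).

(** For i < k, the coordinates of row i of the path matrix with respect to the coefficients c_j(m):
    both heights k - i and k + i + 2 are then positive. *)
Definition seed (i m : nat) : R :=
  (m == k - i)%N%:R - t * q ^+ i.+1 * (m == k + i + 2)%N%:R.

Definition left_factor (i m : nat) : R :=
  if i is i'.+1 then
    if (i' < k)%N then lift_seq u p.*2 (seed i') m
    else q ^+ (i' - k) * (m == i' - k)%N%:R
  else lift_seq u p.*2 (npow x y) m.

Lemma det_path_mx_left n :
  \det (path_mx x y t n k%:Z) = ndet n.+1 left_factor.
Proof.
(* This is the unitriangular factor B, so multiplying by its determinant changes nothing. *)
pose G m j := c j m - u * c j (m + p.*2)%N.
have detG : ndet n.+1 G = 1.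
  rewrite ndet_trig => [|i j ltji].
    by rewrite big1 // => i _; rewrite /G path_sum_diag path_sum_high ?mulr0 ?subr0 //; lia.
  by rewrite /G !path_sum_high ?mulr0 ?subr0 //; lia.
rewrite -[RHS]mulr1 -detG ndet_mul.
have c0 j : (j <= n)%N -> forall m, (n < m)%N -> c j m = 0.
  by move=> lejn m ltnm; rewrite path_sum_high //; lia.
have first_row j : (j <= n)%N ->
    \sum_(m < n.+1) left_factor 0 m * G m j = (j == 0)%:R.
  move=> lejn; rewrite (sum_lift_seq _ _ _ (c0 j lejn)) //.
  case: j lejn => [|j] ltjn; last exact: sum_npow_path_sum_eq0.
  rewrite big_ord_recl big1 => [|m _]; first by rewrite path_sum0 mulr1 addr0.
  by rewrite path_sum0 mulr0.
rewrite (@ndet_row _ _ _ 0 0) // => [|j lejn /negPf neqj0]; last first.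
  by rewrite first_row // neqj0.
rewrite first_row // !mul1r /=.
congr (\det _); apply/matrixP => i j; rewrite !mxE.
rewrite /bump !leq0n !add1n.
rewrite path_sum_shift (path_sum_shift _ _ _ (- _ - _)).
have -> : k%:Z - (- i%:Z - 2) = (k + i + 2)%:Z by lia.
rewrite /left_factor; have [ltik|leki] := ltnP i k.
  rewrite (sum_lift_seq _ _ _ (c0 j.+1 (ltn_ord j))) //.
  under eq_bigr => m _ do rewrite /seed mulrBl -(mulrA _ _%:R).
  rewrite sumrB -mulr_sumr !(sum_delta _ (c0 j.+1 (ltn_ord j))).
  by congr (path_sum _ _ _ _ _ - _); lia.
(* For i >= k the height k - i is at most 0; after reflection the row is q^(i-k) times row i - k of
   [G]. *)
under eq_bigr => m _ do rewrite -mulrA.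
rewrite -mulr_sumr.
have ltr : (i - k < n.+1)%N by have := ltn_ord i; lia.
rewrite (bigD1 (Ordinal ltr)) //= eqxx mul1r big1 ?addr0 => [|m neqm]; last first.
  by rewrite -val_eqE /= in neqm; rewrite (negPf neqm) mul0r.
rewrite /G (_ : k%:Z - i%:Z = - (i - k)%:Z); last lia.
rewrite path_sumN mulrBr (_ : (i - k + p.*2 = k + i + 2)%N); last lia.
rewrite (_ : i.+1 = (i - k + p)%N); last lia.
by rewrite exprD; ring.
Qed.

Lemma seed_eq0 i m : (m != k - i)%N -> (m != k + i + 2)%N -> seed i m = 0.
Proof. by rewrite /seed => /negPf-> /negPf->; rewrite mulr0 subr0. Qed.

Lemma seed_high i m : (i < k)%N -> (p.*2 <= m)%N -> seed i m = 0.
Proof.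
by move=> ltik lem; rewrite seed_eq0 //; lia.
Qed.

Lemma lift_seed i h m : (i < k)%N -> (m < p.*2)%N ->
  lift_seq u p.*2 (seed i) (h * p.*2 + m) = u ^+ h * seed i m.
Proof.
by move=> ltik ltm; rewrite lift_seq_finite // => j; apply: seed_high.
Qed.

(** The support of [seed i] lies in 1..k and k+2..2k+1, thus avoids the residues 0 and p modulo
    2p. *)
Lemma lift_seed_mul i n1 : (i < k)%N -> lift_seq u p.*2 (seed i) (n1 * p) = 0.
Proof.
move=> ltik; rewrite -[n1]odd_double_half.
have -> : ((odd n1 + n1./2.*2) * p = n1./2 * p.*2 + odd n1 * p)%N by lia.
rewrite lift_seed //; last by case: odd; lia.
by rewrite seed_eq0 ?mulr0 //; case: odd; lia.
Qed.

(** * The border row at multiples of k + 1 *)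

Definition weight_sum (n1 : nat) : R :=
  \sum_(s < n1.+1) t ^+ minn s (n1 - s) * x ^+ (s * p)%N * y ^+ ((n1 - s) * p)%N.

(** The two extreme terms carry no t; in each inner term a factor t (xy)^p = u splits off. This is
    the recurrence of [lift_seq] with step 2p. *)
Lemma weight_sumSS n1 :
  weight_sum n1.+2 =
    x ^+ (n1.+2 * p) + y ^+ (n1.+2 * p) + u * weight_sum n1.
Proof.
rewrite {1}/weight_sum big_ord_recl big_ord_recr /=.
rewrite [X in _ + (X + _)](_ : _ = u * weight_sum n1).
  by rewrite /bump leq0n add1n subn0 min0n mul0n subnn minn0 mul0n; ring.
rewrite mulr_sumr; apply: eq_bigr => s _; rewrite /bump /= add1n.
have lts := ltn_ord s.
have -> : (n1.+2 - s.+1 = (n1 - s).+1)%N by lia.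
by rewrite minnSS exprS !mulSn !exprD exprMn; ring.
Qed.

Lemma lift_npow n1 :
  lift_seq u p.*2 (npow x y) (n1 * p) = (-1) ^+ (n1 * p) * weight_sum n1.
Proof.
have npowE m : (0 < m)%N -> npow x y m = (-1) ^+ m * (x ^+ m + y ^+ m).
  by case: m => // m _; rewrite /npow mulrDr -!exprNn.
elim/ltn_ind: n1 => -[|[|n1]] IH.
- rewrite mul0n lift_seq_small // /weight_sum big_ord1 /=.
  by rewrite !mul1r.
- rewrite mul1n lift_seq_small; last lia.
  rewrite npowE // /weight_sum !big_ord_recl big_ord0 /= mul1n !mul1r addr0 mulr1.
  by rewrite [X in _ = _ * X]addrC.
have -> : (n1.+2 * p = n1 * p + p.*2)%N by lia.
rewrite lift_seqD // IH //; have <- : (n1.+2 * p = n1 * p + p.*2)%N by lia.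
rewrite npowE // weight_sumSS.
have -> : (-1) ^+ (n1 * p) = (-1) ^+ (n1.+2 * p) :> R.
  by rewrite -signr_odd -[in RHS]signr_odd !oddM /= negbK.
by ring.
Qed.

(** * Reduction to a window of k + 1 consecutive columns *)

Lemma det_left_window d :
  ndet (d + p) left_factor =
    (-1) ^+ (p * d) * q ^+ 'C(d, 2) * ndet p (fun i j => left_factor i (d + j)).
Proof.
rewrite addnC (@ndet_antiblock _ _ _ _ (fun r => q ^+ r)) ?prod_expr_ord //.
move=> r j _ _; rewrite /left_factor addSn ltnNge leq_addr /=.
by rewrite addKn.
Qed.

(** When the window contains a multiple of p, at offset l, that column is zero below the border row,
    and expansion along it isolates [weight_sum]. *)
Lemma det_path_mx_col n d l n1 : n = (d + k)%N -> (d + l = n1 * p)%N -> (l <= k)%N ->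
  \det (path_mx x y t n k%:Z) =
    (-1) ^+ (p * d + l + n1 * p) * q ^+ 'C(d, 2) * weight_sum n1
    * ndet k (fun i j => lift_seq u p.*2 (seed i) (d + bump l j)).
Proof.
move=> -> dl lelk; rewrite det_path_mx_left -addnS det_left_window.
rewrite (@ndet_col _ _ _ 0 l) // => [|[|i] lei // _]; last first.
  by rewrite dl /= lei lift_seed_mul.
rewrite dl add0n [left_factor 0 _]lift_npow.
rewrite (@eq_ndet _ k _ (fun i j => lift_seq u p.*2 (seed i) (d + bump l j))).
  by rewrite !exprD; ring.
by move=> i j ltik _; rewrite /left_factor /bump leq0n add1n ltik.
Qed.

(** The remaining columns have residues k+2..2k+1 modulo 2p, where only the second delta of each
    seed is met. *)
Lemma det_path_mx_diag n d l n1 h :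
    n = (d + k)%N -> (d + l = n1 * p)%N -> (l <= k)%N ->
    (forall j, (j < k)%N -> d + bump l j = h * p.*2 + (k + j + 2))%N ->
  \det (path_mx x y t n k%:Z) =
    (-1) ^+ (p * d + l + n1 * p + k) * t ^+ (h.+1 * k)
    * q ^+ ('C(d, 2) + p * h * k + 'C(p, 2)) * weight_sum n1.
Proof.
move=> nE dl lelk dj; rewrite (det_path_mx_col nE dl lelk).
have entry i j : (i < k)%N -> (j < k)%N ->
    lift_seq u p.*2 (seed i) (d + bump l j) = u ^+ h * - t * q ^+ i.+1 * (j == i)%:R.
  move=> ltik ltjk; rewrite dj // lift_seed //; last lia.
  rewrite /seed (_ : (k + j + 2 == k - i)%N = false); last lia.
  by rewrite !eqn_add2r eqn_add2l sub0r; ring.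
rewrite ndet_diag => [|i j lti ltj neqij]; last first.
  by rewrite entry // eq_sym (negPf neqij) mulr0.
under eq_bigr => i _ do rewrite entry ?eqxx ?mulr1 ?ltn_ord //.
rewrite big_split /= prodr_const card_ord.
have -> : \prod_(i < k) q ^+ i.+1 = q ^+ 'C(p, 2).
  by rewrite -prod_expr_ord big_ord_recl mul1r.
have -> : (u ^+ h * - t) ^+ k = (-1) ^+ k * t ^+ (h.+1 * k) * q ^+ (p * h * k).
  rewrite (exprMn k) (exprNn t) -exprM (exprMn (h * k)%N) -exprM mulnA.
  by rewrite mulSn (exprD t); ring.
by rewrite !exprD; ring.
Qed.

(** The remaining columns have residues 1..k modulo 2p, where only the first delta of each seed is
    met, in reversed order. *)
Lemma det_path_mx_antidiag n d l n1 h :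
    n = (d + k)%N -> (d + l = n1 * p)%N -> (l <= k)%N ->
    (forall j, (j < k)%N -> d + bump l j = h * p.*2 + j.+1)%N ->
  \det (path_mx x y t n k%:Z) =
    (-1) ^+ (p * d + l + n1 * p + 'C(k, 2)) * t ^+ (h * k)
    * q ^+ ('C(d, 2) + p * h * k) * weight_sum n1.
Proof.
move=> nE dl lelk dj; rewrite (det_path_mx_col nE dl lelk).
have entry i j : (i < k)%N -> (j < k)%N ->
    lift_seq u p.*2 (seed i) (d + bump l j) = u ^+ h * (i + j.+1 == k)%N%:R.
  move=> ltik ltjk; rewrite dj // lift_seed //; last lia.
  rewrite /seed (_ : (j.+1 == k + i + 2)%N = false); last lia.
  by rewrite mulr0 subr0; congr (_ * _%:R); lia.
rewrite ndet_antidiag => [|i j lti ltj neqij]; last first.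
  by rewrite entry // addnS (negPf neqij) mulr0.
rewrite (eq_bigr (fun=> u ^+ h)) => [|i _]; last first.
  have lti := ltn_ord i; rewrite entry //; last lia.
  by rewrite (_ : (_ == k) = true) ?mulr1 //; lia.
rewrite prodr_const card_ord -exprM (exprMn (h * k)%N) -exprM mulnA !exprD.
by ring.
Qed.

(** * Evaluation according to n modulo k + 1 *)

Lemma det_path_mx_mul n n1 : (0 < n)%N -> n = (n1 * p)%N ->
  \det (path_mx x y t n k%:Z) =
    (-1) ^+ (n1 * 'C(p, 2)) * t ^+ (k * n1./2)
    * q ^+ (p ^ 2 * 'C(n1, 2)) * weight_sum n1.
Proof.
move=> n_gt0 nE; rewrite -[n1]odd_double_half in nE *.
set h := n1./2 in nE *; case: (odd n1) nE; rewrite ?add0n ?add1n => nE; last first.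
  case: h nE => [|h] nE; first by rewrite nE in n_gt0.
  (* The window ends at n = n1 p, hence l = k; the parity of n1 decides which half of the period 2p
     precedes it. *)
  rewrite (@det_path_mx_diag n (h.*2.+1 * p).+1 k h.+1.*2 h) //; try lia.
    (* These identities eliminate the binomials, so that comparing the exponents of xy becomes
       polynomial arithmetic. *)
    have Cp := bin2_double p; have Cd := bin2_double (h.*2.+1 * p).+1.
    have Ch := congr1 (muln (p * p)) (bin2_double h.+1.*2).
    congr (_ * _ * _ * _).
    - apply: signr_eq_odd.
      rewrite ?(binS k 1) ?bin1 !(oddD, oddM, oddS, odd_double) /=.
      by case: (odd k); case: (odd h); case: (odd 'C(k, 2)).
    - by congr (_ ^+ _); rewrite [_./2](_ : _ = h.+1); lia.
    by congr (_ ^+ _); rewrite -mulnn; lia.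
  by move=> j ltjk; rewrite /bump; lia.
rewrite (@det_path_mx_antidiag n (h.*2 * p).+1 k h.*2.+1 h) //; try lia.
  have Cp := bin2_double p; have Cd := bin2_double (h.*2 * p).+1.
  have Ch := congr1 (muln (p * p)) (bin2_double h.*2.+1).
  congr (_ * _ * _ * _).
  - apply: signr_eq_odd.
    rewrite ?(binS k 1) ?bin1 !(oddD, oddM, oddS, odd_double) /=.
    by case: (odd k); case: (odd h); case: (odd 'C(k, 2)).
  - by congr (_ ^+ _); rewrite [_./2](_ : _ = h); lia.
  by congr (_ ^+ _); rewrite -mulnn; lia.
by move=> j ltjk; rewrite /bump; lia.
Qed.

Lemma det_path_mx_mulD n n1 : n = (n1 * p + k)%N ->
  \det (path_mx x y t n k%:Z) =
    (-1) ^+ (n1 * 'C(p, 2) + 'C(k, 2)) * t ^+ (k * uphalf n1)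
    * q ^+ (p ^ 2 * 'C(n1, 2) + n1 * k * p) * weight_sum n1.
Proof.
move=> nE; rewrite -[n1]odd_double_half in nE *.
set h := n1./2 in nE *; case: (odd n1) nE; rewrite ?add0n ?add1n => nE; last first.
  (* Now the window starts at the multiple n1 p, hence l = 0, and the roles of the two parities are
     exchanged. *)
  rewrite (@det_path_mx_antidiag n (h.*2 * p) 0 h.*2 h) //; try lia.
    have Cp := bin2_double p; have Cd := bin2_double (h.*2 * p).
    have Ch := congr1 (muln (p * p)) (bin2_double h.*2).
    congr (_ * _ * _ * _).
    - apply: signr_eq_odd.
      rewrite ?(binS k 1) ?bin1 !(oddD, oddM, oddS, odd_double) /=.
      by case: (odd k); case: (odd h); case: (odd 'C(k, 2)).
    - by congr (_ ^+ _); rewrite [uphalf _](_ : _ = h); lia.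
    by congr (_ ^+ _); rewrite -mulnn; lia.
  by move=> j ltjk; rewrite /bump; lia.
rewrite (@det_path_mx_diag n (h.*2.+1 * p) 0 h.*2.+1 h) //; try lia.
  have Cp := bin2_double p; have Cd := bin2_double (h.*2.+1 * p).
  have Ch := congr1 (muln (p * p)) (bin2_double h.*2.+1).
  congr (_ * _ * _ * _).
  - apply: signr_eq_odd.
    rewrite ?(binS k 1) ?bin1 !(oddD, oddM, oddS, odd_double) /=.
    by case: (odd k); case: (odd h); case: (odd 'C(k, 2)).
  - by congr (_ ^+ _); rewrite [uphalf _](_ : _ = h.+1); lia.
  by congr (_ ^+ _); rewrite -mulnn; lia.
by move=> j ltjk; rewrite /bump; lia.
Qed.

Lemma det_path_mx_eq0 n : n <> 0 %[mod p] -> n <> k %[mod p] ->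
  \det (path_mx x y t n k%:Z) = 0.
Proof.
rewrite mod0n (modn_small (ltnSn k)) => n0 nk.
have ltrp := ltn_pmod n (ltn0Sn k); have nE := divn_eq n p.
set r := (n %% p)%N in n0 nk ltrp nE; set n1 := (n %/ p)%N in nE.
(* The columns [n - k .. n] avoid the residues [k] and [-k] modulo [2 p] when
   [n %/ p] is even, and the residues [1] and [-1] when it is odd; so one of
   the corresponding rows vanishes on them. *)
have [a ltak aE] : exists2 a, (a < k)%N & a = (if odd n1 then k.-1 else 0%N).
  by exists (if odd n1 then k.-1 else 0%N) => //; case: odd; lia.
have window0 m : (n - k <= m <= n)%N -> lift_seq u p.*2 (seed a) m = 0.
  case/andP=> lem lemn; set h := n1./2.
  have {nE}nE : n = (h * p.*2 + (odd n1 * p + r))%N.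
    by rewrite nE -[in LHS](odd_double_half n1) -/h; lia.
  (* The window may reach back into the preceding period of length 2p. *)
  have [leBm|ltmB] := leqP (h * p.*2) m.
    rewrite -(subnKC leBm) lift_seed ?seed_eq0 ?mulr0 //;
      by move: (h * _)%N nE leBm aE; case: odd => B nE leBm aE; lia.
  case: h nE ltmB => [|h]; first by rewrite mul0n.
  rewrite mulSn addnC => nE ltmB.
  have leBm : (h * p.*2 <= m)%N by move: (h * _)%N nE ltmB => B; lia.
  rewrite -(subnKC leBm) lift_seed ?seed_eq0 ?mulr0 //;
    by move: (h * _)%N nE ltmB leBm aE; case: odd => B nE ltmB leBm aE; lia.
(* If n < k, there are fewer than k + 1 columns and no window to cut out: the row vanishes on all of
   them. *)
rewrite det_path_mx_left; have [ltnk|lekn] := ltnP n k.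
  have n1_0 : n1 = 0%N by rewrite /n1 divn_small //; lia.
  rewrite n1_0 /= in aE nE.
  rewrite (@ndet_row_eq0 _ _ _ a.+1) //; first lia.
  by move=> j lej; rewrite /left_factor ltak window0 //; lia.
have -> : n.+1 = ((n - k) + p)%N by lia.
rewrite det_left_window (@ndet_row_eq0 _ _ _ a.+1) ?mulr0 // => j ltj.
by rewrite /left_factor ltak window0 //; lia.
Qed.

End PathDet.

Theorem theorem9 (n : nat) (hn : (0 < n)%N) :
  let x : {mpoly int[3]} := 'X_(@Ordinal 3 0 isT) in
  let y : {mpoly int[3]} := 'X_(@Ordinal 3 1 isT) in
  let t : {mpoly int[3]} := 'X_(@Ordinal 3 2 isT) in
  (forall k : nat,
     [/\ forall n1 : nat, n = (n1 * k.+1)%N ->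
           \det (path_mx x y t n k%:Z)
           = (-1) ^+ (n1 * 'C(k.+1, 2))%N
             * t ^+ (k * n1./2)%N
             * (x * y) ^+ (k.+1 ^ 2 * 'C(n1, 2))%N
             * \sum_(s < n1.+1)
                 t ^+ minn s (n1 - s)
                 * x ^+ (s * k.+1)%N * y ^+ ((n1 - s) * k.+1)%N,
         forall n1 : nat, n = (n1 * k.+1 + k)%N ->
           \det (path_mx x y t n k%:Z)
           = (-1) ^+ (n1 * 'C(k.+1, 2) + 'C(k, 2))%N
             * t ^+ (k * uphalf n1)%N
             * (x * y) ^+ (k.+1 ^ 2 * 'C(n1, 2) + n1 * k * k.+1)%N
             * \sum_(s < n1.+1)
                 t ^+ minn s (n1 - s)
                 * x ^+ (s * k.+1)%N * y ^+ ((n1 - s) * k.+1)%N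
       & n <> 0 %[mod k.+1] -> n <> k %[mod k.+1] ->
           \det (path_mx x y t n k%:Z) = 0])
  /\ \det (path_mx x y t n (-1)) = (1 - t) ^+ n * (x * y) ^+ 'C(n.+1, 2).
Proof.
move=> x y t; split; last exact: det_path_mx_neg1.
move=> k; split; [move=> n1 nE|move=> n1 nE|].
- exact: det_path_mx_mul.
- exact: det_path_mx_mulD.
- exact: det_path_mx_eq0.
Qed.
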